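(* Let $S$ be the finite bounded graded poset of rank $3$ with elements $\hat 0,x_1,x_2,x_3,x_4,y_1,\dots,y_8,\hat 1$ whose cover relations are exactly the following: $\hat 0\lessdot x_1,x_2,x_3,x_4$; $x_1\lessdot y_1,y_2,y_3$; $x_2\lessdot y_3,y_4,y_5$; $x_3\lessdot y_4,y_5,y_6$; $x_4\lessdot y_6,y_7,y_8$; and $y_i\lessdot\hat 1$ for $i=1,\dots,8$. Then $S$ is EL-shellable.
   Context: Write $s\lessdot t$ if $t$ covers $s$; the notation $x\lessdot a,b,c$ means that $x$ is covered by each of $a,b,c$. For a finite graded bounded poset $P$, let $\mathcal{E}(P)$ be the set of pairs $(s,t)$ with $s\lessdot t$. An edge labeling is a map $\lambda:\mathcal{E}(P)\to\Lambda$, where $\Lambda$ is a totally ordered set. A maximal chain $s=u_0\lessdot u_1\lessdot\cdots\lessdot u_k=t$ of the interval $[s,t]$ has label word $\lambda(u_0,u_1)\cdots\lambda(u_{k-1},u_k)$. The labeling $\lambda$ is an EL-labeling if for all $s\leqslant t$ in $P$ there is a unique maximal chain of $[s,t]$ whose label word is weakly increasing (as the rank increases), and this chain's label word is lexicographically minimal among the label words of all maximal chains of $[s,t]$. $P$ is EL-shellable if it admits an EL-labeling (for some totally ordered set $\Lambda$). *)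

(* Defs.v *)
From HB Require Import structures.
From mathcomp Require Import all_boot all_order.

Set Implicit Arguments.
Unset Strict Implicit.
Unset Printing Implicit Defensive.

Import Order.TTheory.
Local Open Scope order_scope.

Section ELShellability.
Context {d : Order.disp_t} {P : finTBPOrderType d}.

Definition covers (s t : P) : bool :=
  (s < t) && ~~ [exists u, (s < u) && (u < t)].

(* The maximal chain s = u_0 <. u_1 <. ... <. u_k = t of [s, t] is encoded by
   the sequence [:: u_1; ...; u_k]: as usual for paths, its origin s is left
   out.  Every u_i lies in [s, t] because the chain is saturated. *)
Definition maximal_chain (s t : P) (c : seq P) : bool :=
  path covers s c && (last s c == t).

Definition graded_of_rank (n : nat) : Prop :=
  forall c : seq P, maximal_chain \bot \top c -> size c = n.

Section Labeling.
Context {d' : Order.disp_t} {L : orderType d'}.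

(* An edge labeling is given by a function on all pairs of elements; only its
   values on the pairs (s, t) with t covering s are ever used. *)
Implicit Types lam : P -> P -> L.

(* For c = [:: u_1; ...; u_k] this is
   [:: lam s u_1; lam u_1 u_2; ...; lam u_(k-1) u_k]. *)
Definition label_word lam (s : P) (c : seq P) : seqlexi L := pairmap lam s c.

Definition increasing_chain lam (s t : P) (c : seq P) : bool :=
  maximal_chain s t c && sorted <=%O (label_word lam s c : seq L).

(* The order in the last clause is the lexicographic order of seqlexi L. *)
Definition EL_labeling lam : Prop :=
  forall s t : P, s <= t ->
    exists c : seq P,
      [/\ increasing_chain lam s t c,
          forall c', increasing_chain lam s t c' -> c' = c
        & forall c', maximal_chain s t c' ->
            label_word lam s c <= label_word lam s c'].

End Labeling.
End ELShellability.

Arguments graded_of_rank {d} P n.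

(* EL-shellability is a property of graded posets, hence the first clause. *)
Definition EL_shellable {d : Order.disp_t} (P : finTBPOrderType d) : Prop :=
  (exists n, graded_of_rank P n) /\
  exists (d' : Order.disp_t) (L : orderType d') (lam : P -> P -> L),
    EL_labeling lam.

Variant poset_S : Set :=
  | S_0 | X1 | X2 | X3 | X4 | Y1 | Y2 | Y3 | Y4 | Y5 | Y6 | Y7 | Y8 | S_1.

(* Ordinal rather than inord, so that equality on poset_S computes. *)
Definition S_index (a : poset_S) : 'I_14 :=
  match a with
  | S_0 => @Ordinal 14 0 isT
  | X1 => @Ordinal 14 1 isT
  | X2 => @Ordinal 14 2 isT
  | X3 => @Ordinal 14 3 isT
  | X4 => @Ordinal 14 4 isT
  | Y1 => @Ordinal 14 5 isT
  | Y2 => @Ordinal 14 6 isT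
  | Y3 => @Ordinal 14 7 isT
  | Y4 => @Ordinal 14 8 isT
  | Y5 => @Ordinal 14 9 isT
  | Y6 => @Ordinal 14 10 isT
  | Y7 => @Ordinal 14 11 isT
  | Y8 => @Ordinal 14 12 isT
  | S_1 => @Ordinal 14 13 isT
  end.

Definition S_elt (i : 'I_14) : poset_S :=
  nth S_0 [:: S_0; X1; X2; X3; X4; Y1; Y2; Y3; Y4; Y5; Y6; Y7; Y8; S_1] i.

Lemma S_indexK : cancel S_index S_elt.
Proof. by case. Qed.

HB.instance Definition _ := Finite.copy poset_S (can_type S_indexK).

Definition S_upper_covers (a : poset_S) : seq poset_S :=
  match a with
  | S_0 => [:: X1; X2; X3; X4]
  | X1 => [:: Y1; Y2; Y3]
  | X2 => [:: Y3; Y4; Y5]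
  | X3 => [:: Y4; Y5; Y6]
  | X4 => [:: Y6; Y7; Y8]
  | Y1 | Y2 | Y3 | Y4 | Y5 | Y6 | Y7 | Y8 => [:: S_1]
  | S_1 => [::]
  end.

Definition S_edge : rel poset_S := fun a b => b \in S_upper_covers a.

Definition S_rank (a : poset_S) : nat :=
  match a with
  | S_0 => 0
  | X1 | X2 | X3 | X4 => 1
  | Y1 | Y2 | Y3 | Y4 | Y5 | Y6 | Y7 | Y8 => 2
  | S_1 => 3
  end.

(* The order of S is the reflexive transitive closure of its edges. *)
Definition S_le : rel poset_S := connect S_edge.

Lemma S_edgeP (Q : poset_S -> poset_S -> Prop) :
  (forall a, foldr (fun b R => Q a b /\ R) True (S_upper_covers a)) ->
  forall a b, S_edge a b -> Q a b.
Proof.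
move=> H a b; rewrite /S_edge; move: (H a).
elim: (S_upper_covers a) => //= c s IH [Qc /IH{}IH].
by rewrite inE => /orP[/eqP->|/IH].
Qed.

Lemma S_rank_edge a b : S_edge a b -> S_rank b = (S_rank a).+1.
Proof. by move: a b; apply: S_edgeP; case; do !split. Qed.

Lemma S_rank_path a p :
  path S_edge a p -> S_rank (last a p) = (S_rank a + size p)%N.
Proof.
elim: p a => [|b p IH] a /=; first by rewrite addn0.
by case/andP=> /S_rank_edge rb /IH->; rewrite rb addSnnS.
Qed.

Fact S_le_refl : reflexive S_le.
Proof. exact: connect0. Qed.

Fact S_le_trans : transitive S_le.
Proof. exact: connect_trans. Qed.

Fact S_le_anti : antisymmetric S_le.
Proof.
move=> a b /andP[/connectP[p ep ->] /connectP[q eq Ea]].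
have := S_rank_path eq; rewrite -Ea (S_rank_path ep) -addnA => /eqP.
by rewrite -[X in X == _]addn0 eqn_add2l eq_sym addn_eq0 => /andP[/nilP->].
Qed.

Fact S_display : Order.disp_t. Proof. exact: (Order.Disp tt tt). Qed.

HB.instance Definition _ :=
  Order.Le_isPOrder.Build S_display poset_S S_le_refl S_le_anti S_le_trans.

Lemma S_edge_le a b : S_edge a b -> a <= b.
Proof. exact: connect1. Qed.

Fact S_0_le (a : poset_S) : S_0 <= a.
Proof.
have leX b : b \in S_upper_covers S_0 -> S_0 <= b by exact: (@S_edge_le S_0).
have leY b c : b \in S_upper_covers S_0 -> S_edge b c -> S_0 <= c.
  by move=> /leX + /S_edge_le; apply: le_trans.
have le1 : S_0 <= S_1.
  exact: le_trans (leY X1 Y1 isT isT) (@S_edge_le Y1 S_1 isT).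
by case: a => //; do ?[exact: leX | exact: (leY X1) | exact: (leY X2)
  | exact: (leY X3) | exact: (leY X4)].
Qed.

Fact S_le_1 (a : poset_S) : a <= S_1.
Proof.
have leY b : S_rank b = 2 -> b <= S_1 by case: b => // _; apply: S_edge_le.
have leX b c : S_edge b c -> S_rank c = 2 -> b <= S_1.
  by move=> /S_edge_le + /leY; apply: le_trans.
by case: a; do ?[exact: S_0_le | exact: leY | exact: (leX _ Y1)
  | exact: (leX _ Y4) | exact: (leX _ Y6) | exact: lexx].
Qed.

HB.instance Definition _ := Order.hasBottom.Build S_display poset_S S_0_le.
HB.instance Definition _ := Order.hasTop.Build S_display poset_S S_le_1.

Lemma covers_SE : @covers _ poset_S =2 S_edge.
Proof.
have ltr (a b : poset_S) : a < b -> (S_rank a < S_rank b)%N.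
  rewrite lt_neqAle => /andP[nab /connectP[[|c p] ep Eb]].
    by rewrite Eb eqxx in nab.
  by rewrite Eb (S_rank_path ep) /= addnS ltnS leq_addr.
move=> a b; apply/andP/idP => [[ltab /existsP nab]|eab].
  have /connectP[[|c p] ep Eb] : S_le a b := ltW ltab.
    by rewrite Eb ltxx in ltab.
  move: ep => /= /andP[eac ep].
  suff <- : c = b by [].
  apply/eqP; apply: contraT => ncb; case: nab; exists c.
  rewrite !lt_neqAle ncb (S_edge_le eac) andbT.
  apply/andP; split.
    by apply/eqP => Eac; move: (S_rank_edge eac); rewrite Eac => /n_Sn.
  by apply/connectP; exists p.
have rab := S_rank_edge eab; split.
  rewrite lt_neqAle (S_edge_le eab) andbT.
  by apply/eqP => Eab; move: rab; rewrite Eab => /n_Sn.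
apply/existsP => -[c /andP[/ltr ac /ltr]].
by rewrite rab ltnS leqNgt ac.
Qed.

Lemma S_graded : graded_of_rank poset_S 3.
Proof.
move=> c /andP[]; rewrite (eq_path covers_SE) => /S_rank_path + /eqP Ec.
by rewrite Ec.
Qed.

(* Main.v *)
Require Import Defs.
From mathcomp Require Import all_boot all_order.

(** The poset is EL-shellable because an explicit labeling by natural numbers
    works.  Edges into the top are labelled [0], and the edge from the bottom to
    the atom [x_i] is labelled [i - 1].  The labels of the edges [x_i <. y] are
    then constrained by the intervals as follows.

    - In the interval from [x_i] to the top the second label is always [0], so
      the increasing chains are those whose first label is [0], and such a chain
      is lexicographically minimal.  Hence each [x_i] needs exactly one edge
      labelled [0].
    - In the interval from the bottom to [y] the chains have distinct first
      labels, so the one through the atom of least index has to be the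
      increasing one: [x_i <. y] must have label at least [i - 1] if [x_i] is
      the first atom below [y], and at most [i - 2] otherwise.
    - In the interval from the bottom to the top every word ends in [0], so the
      only increasing word is [0 0 0].  It comes from [x_1] followed by its edge
      labelled [0], and it is lexicographically minimal.

    The first two requirements are compatible because each of [x_2], [x_3] and
    [x_4] has an upper cover, namely [y_3], [y_4] and [y_6], already lying above
    an earlier atom; the edge to it can be labelled [0].  For [x_1] the label
    [0] is allowed on any edge.

    Since the poset has few saturated chains, they are listed
    ([saturated_chainsP]) and the conditions of an EL-labeling, which are
    decidable, are evaluated on the lists ([EL_checkT]). *)

Set Implicit Arguments.
Unset Strict Implicit.
Unset Printing Implicit Defensive.

Import Order.TTheory.
Local Open Scope order_scope.

(** On an edge [x_i <. y] where [x_i] is the first atom below [y] the label is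
    [i - 1], except that two of the three edges from [x_1] must avoid [0] and
    get [1].  The remaining edges get [0], except the one from [x_3] to [y_5]:
    as [x_3 <. y_4] is already labelled [0], its label must be positive, and it
    must be less than [2] because [x_2] is also below [y_5]. *)
Definition S_label (a b : poset_S) : nat :=
  match a, b with
  | S_0, X2 => 1
  | S_0, X3 => 2
  | S_0, X4 => 3
  | X1, (Y2 | Y3) => 1
  | X2, (Y4 | Y5) => 1
  | X3, Y5 => 1
  | X3, Y6 => 2
  | X4, (Y7 | Y8) => 3
  | _, _ => 0
  end.

Fixpoint saturated_chains (n : nat) (s : poset_S) : seq (seq poset_S) :=
  [::] :: (if n is n'.+1 then
             [seq u :: c | u <- S_upper_covers s, c <- saturated_chains n' u]
           else [::]).

Lemma saturated_chainsP n s c :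
  reflect (path S_edge s c /\ (size c <= n)%N) (c \in saturated_chains n s).
Proof.
apply: (iffP idP).
  elim: n s c => [|n IH] s c /=; rewrite inE; first by move/eqP->.
  case/orP=> [/eqP-> //|/allpairsPdep[u [c' [su /IH[pc' sc'] ->]]]].
  by rewrite /= {1}/S_edge su.
elim: n s c => [|n IH] s [|u c] //= [/andP[su pc]] //; rewrite ltnS => sc.
rewrite in_cons /=; apply/allpairsPdep.
by exists u, c; split=> //; apply: IH.
Qed.

(** The bound 3 is the rank of the top, so it misses no saturated chain. *)
Definition maximal_chains (s t : poset_S) : seq (seq poset_S) :=
  [seq c <- saturated_chains 3 s | last s c == t].

Lemma mem_maximal_chains s t c :
  (c \in maximal_chains s t) = maximal_chain s t c.
Proof.
rewrite mem_filter /maximal_chain (eq_path covers_SE) andbC.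
congr (_ && _); apply/saturated_chainsP/idP => [[]//|pc]; split=> //.
apply: leq_trans (leq_addl (S_rank s) _) _.
by rewrite -(S_rank_path pc); case: (last s c).
Qed.

Lemma maximal_chains_neq0 s t : s <= t -> maximal_chains s t != [::].
Proof.
case/connectP=> c pc Et.
have: c \in maximal_chains s t.
  by rewrite mem_maximal_chains /maximal_chain (eq_path covers_SE) pc Et /=.
by case: (maximal_chains s t).
Qed.

(** On a listed chain, being increasing reduces to having a sorted word; the
    check thus avoids evaluating the relation [covers], whose definition
    quantifies over the whole poset.  An empty list means that [s <= t] fails. *)
Definition EL_check (s t : poset_S) : bool :=
  let cs := maximal_chains s t in
  let increasing c := sorted <=%O (label_word S_label s c : seq nat) in
  nilp cs ||
  has (fun c => increasing c &&
    all (fun c' => (increasing c' ==> (c' == c)) &&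
                   (label_word S_label s c <= label_word S_label s c')) cs) cs.

Lemma EL_checkT s t : EL_check s t.
Proof. by case: s; case: t; vm_compute. Qed.

Lemma S_label_EL : EL_labeling S_label.
Proof.
move=> s t /maximal_chains_neq0 nz.
have := EL_checkT s t; rewrite /EL_check /nilp size_eq0 (negPf nz) /=.
case/hasP=> c; rewrite mem_maximal_chains => mc /andP[ic /allP Hc].
exists c; split=> [|c' /andP[mc' ic']|c' mc'].
- by rewrite /increasing_chain mc.
- move: mc'; rewrite -mem_maximal_chains => /Hc/andP[/implyP Ec _].
  exact/eqP/Ec.
- by move: mc'; rewrite -mem_maximal_chains => /Hc/andP[].
Qed.

Theorem claim5p2 : EL_shellable poset_S.
Proof.
split; first by exists 3; exact: S_graded.
by exists _, nat, S_label; exact: S_label_EL.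
Qed.
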